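(* Let $(X,\delta)$ be a finite ordinal space with $|X|\geqslant2$, and suppose $X$ is embeddable in $\mathbb R^1$. Then the following conditions hold: (i) $|\Delta(X)|\geqslant|X|-1$. (ii) If $\Delta(X)=\{\delta_1,\delta_2,\ldots,\delta_k\}$ with $\delta_1>\delta_2>\ldots>\delta_k$, then $|\delta_1|=1$ and $|\delta_i|\leqslant i$ for $i=2,\ldots,k$.
   Context: An ordinal space is an ordered triplet $(X,L,\delta)$, also written $(X,\delta)$, where $X$ is a set, $L$ is a linearly ordered set with minimal element $0$, and $\delta\colon X\times X\to L$ is a surjective mapping such that for all $x,y\in X$: (i) $\delta(x,y)=\delta(y,x)$; (ii) $\delta(x,y)=0$ if and only if $x=y$. $X$ is embeddable in $\mathbb R^m$ (written $X\hookrightarrow\mathbb R^m$) if there is a mapping $\Phi\colon X\to\mathbb R^m$ such that for all $x,y,z,w\in X$ the comparison ($<$, $=$ or $>$) of $\delta(x,y)$ with $\delta(z,w)$ is the same as that of the Euclidean distances $d(\Phi(x),\Phi(y))$ and $d(\Phi(z),\Phi(w))$. $\Delta(X)$ denotes the set of equivalence classes of the relation $\delta(x,y)=\delta(z,w)$ on the set of unordered pairs $\{x,y\}$ with $x,y\in X$, $x\neq y$. For classes $\delta_i,\delta_j\in\Delta(X)$ write $\delta_i>\delta_j$ if $\delta(x,y)>\delta(z,w)$ for some $\{x,y\}\in\delta_i$ and some $\{z,w\}\in\delta_j$. $|\delta_i|$ is the number of unordered pairs in the class $\delta_i$. *)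

(* Defs.v *)
From mathcomp Require Import all_boot all_order all_algebra.
From mathcomp Require Import reals.

Set Implicit Arguments.
Unset Strict Implicit.
Unset Printing Implicit Defensive.

Import Order.TTheory GRing.Theory Num.Theory.

Local Open Scope ring_scope.

(* The distinguished element 0 of the value set L is the bottom element of L. *)
Record ordinal_space (X : Type) (disp : Order.disp_t) (L : bOrderType disp)
    (delta : X -> X -> L) : Prop := OrdinalSpace {
  ordinal_space_surj : forall l : L, exists x y : X, delta x y = l;
  ordinal_space_sym : forall x y : X, delta x y = delta y x;
  ordinal_space_eq0 : forall x y : X, delta x y = \bot%O <-> x = y }.

(* The norm that MathComp-Analysis puts on 'rV[R]_m is the sup norm, hence an
   explicit Euclidean distance. *)
Definition euclidean_dist (R : realType) (m : nat) (u v : 'rV[R]_m) : R :=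
  Num.sqrt (\sum_(i < m) (u ord0 i - v ord0 i) ^+ 2).

Definition embeddable (R : realType) (m : nat) (X : Type)
    (disp : Order.disp_t) (L : bOrderType disp) (delta : X -> X -> L) : Prop :=
  exists Phi : X -> 'rV[R]_m, forall x y z w : X,
    [/\ (delta x y < delta z w)%O <->
          euclidean_dist (Phi x) (Phi y) < euclidean_dist (Phi z) (Phi w),
        delta x y = delta z w <->
          euclidean_dist (Phi x) (Phi y) = euclidean_dist (Phi z) (Phi w)
      & (delta x y > delta z w)%O <->
          euclidean_dist (Phi x) (Phi y) > euclidean_dist (Phi z) (Phi w)].

(* An unordered pair {x, y} with x != y is a two-element set. *)
Definition unordered_pairs (X : finType) : {set {set X}} :=
  [set A : {set X} | #|A| == 2%N].

Definition same_delta (X : finType) (disp : Order.disp_t) (L : bOrderType disp)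
    (delta : X -> X -> L) : rel {set X} :=
  fun A B => [exists x, exists y, exists z, exists w,
    [&& A == [set x; y], B == [set z; w] & delta x y == delta z w]].

Definition Delta (X : finType) (disp : Order.disp_t) (L : bOrderType disp)
    (delta : X -> X -> L) : {set {set {set X}}} :=
  equivalence_partition (same_delta delta) (unordered_pairs X).

Definition class_gt (X : finType) (disp : Order.disp_t) (L : bOrderType disp)
    (delta : X -> X -> L) (C D : {set {set X}}) : Prop :=
  exists x y z w : X,
    [/\ [set x; y] \in C, [set z; w] \in D & (delta x y > delta z w)%O].

(* Main.v *)
Require Import Defs.
From mathcomp Require Import all_boot all_order all_algebra.
From mathcomp Require Import reals.

(** An embedding into the line is an injective coordinate [f : X -> R] for which
    [delta] compares pairs as [`|f x - f y|] does. Everything follows from looking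
    at the distances from the leftmost point [x0]. On the line two points on the
    same side of [x0] are at different distances from it, so the pairs [{x0, y}],
    with [y != x0], lie in [#|X| - 1] pairwise different classes: this is (i).

    For (ii), let [C] be the class of distance [d]. A pair in [C] is determined by
    its right endpoint [y], the left one having coordinate [f y - d]
    ([card_class_right_ends]). Such a [y] satisfies [f y - f x0 >= d] because [x0]
    is leftmost, so the class of [{x0, y}] is [C] or a larger class. As [y] varies
    these classes are pairwise different, hence [#|C|] is at most the number of
    classes that are at least [C]; for the [i]-th largest class this number is [i].
    The largest class has exactly one pair since classes are nonempty. *)

Set Implicit Arguments.
Unset Strict Implicit.
Unset Printing Implicit Defensive.

Import Order.TTheory GRing.Theory Num.Theory.

Local Open Scope ring_scope.

Definition pair_class (X : finType) (disp : Order.disp_t) (L : bOrderType disp)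
    (delta : X -> X -> L) (x y : X) : {set {set X}} :=
  [set A in unordered_pairs X | same_delta delta [set x; y] A].

(** Both orders being total, agreement of the strict comparisons already gives
    agreement of [<=] and of [=]. *)
Definition line_coordinate (R : realType) (X : finType) (disp : Order.disp_t)
    (L : bOrderType disp) (delta : X -> X -> L) (f : X -> R) : Prop :=
  injective f /\
  forall x y z w,
    (delta x y < delta z w)%O = (`|f x - f y| < `|f z - f w|).

Definition right_ends (R : realType) (X : finType) (disp : Order.disp_t)
    (L : bOrderType disp) (delta : X -> X -> L) (f : X -> R) (l : L) : {set X} :=
  [set y | [exists x, (f x < f y) && (delta x y == l)]].

Lemma euclidean_dist1 (R : realType) (u v : 'rV[R]_1) :
  euclidean_dist u v = `|u ord0 ord0 - v ord0 ord0|.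
Proof. by rewrite /euclidean_dist big_ord1 sqrtr_sqr. Qed.

Lemma embeddable1_coordinate (R : realType) (X : finType) (disp : Order.disp_t)
    (L : bOrderType disp) (delta : X -> X -> L) :
  ordinal_space delta -> embeddable R 1 delta ->
  exists f : X -> R, line_coordinate delta f.
Proof.
move=> [_ _ d0] [Phi HPhi]; exists (fun x => Phi x ord0 ord0); split.
  move=> x y fxy; apply/d0; rewrite -(proj2 (d0 x x) erefl).
  by have [_ [_ ->]] := HPhi x y x x; rewrite // !euclidean_dist1 fxy.
move=> x y z w; rewrite -!euclidean_dist1.
by have [[lt1 lt2] _ _] := HPhi x y z w; apply/idP/idP.
Qed.

Lemma line_coordinate_le (R : realType) (X : finType) (disp : Order.disp_t)
    (L : bOrderType disp) (delta : X -> X -> L) (f : X -> R) x y z w :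
  line_coordinate delta f ->
  (delta x y <= delta z w)%O = (`|f x - f y| <= `|f z - f w|).
Proof. by move=> [_ ltf]; rewrite !leNgt ltf. Qed.

Lemma line_coordinate_eq (R : realType) (X : finType) (disp : Order.disp_t)
    (L : bOrderType disp) (delta : X -> X -> L) (f : X -> R) x y z w :
  line_coordinate delta f ->
  (delta x y == delta z w) = (`|f x - f y| == `|f z - f w|).
Proof. by move=> Hf; rewrite !eq_le !(line_coordinate_le _ _ _ _ Hf). Qed.

(** The relation [same_delta] on two-element sets quantifies over their
    enumerations; symmetry makes the chosen enumeration immaterial. *)
Lemma sym_set2 (X : finType) (T : Type) (delta : X -> X -> T) x y z w :
  (forall a b, delta a b = delta b a) ->
  [set x; y] = [set z; w] -> delta x y = delta z w.
Proof.
move=> dC /setP eqA.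
move: (eqA x) (eqA y) (eqA z) (eqA w); rewrite !inE !eqxx ?orbT /=.
move=> /esym/orP[]/eqP-> /esym/orP[]/eqP-> //.
- by move=> _; rewrite orbb => /eqP->.
- by rewrite orbb => /eqP->.
Qed.

Lemma same_delta_set2 (X : finType) (disp : Order.disp_t) (L : bOrderType disp)
    (delta : X -> X -> L) x y z w :
  (forall a b, delta a b = delta b a) ->
  same_delta delta [set x; y] [set z; w] = (delta x y == delta z w).
Proof.
move=> dC; apply/existsP/eqP=> [[a /existsP[b /existsP[c /existsP[d]]]]|eqd].
  case/and3P=> /eqP eqA /eqP eqB /eqP eqd.
  by rewrite (sym_set2 dC eqA) (sym_set2 dC eqB).
exists x; apply/existsP; exists y; apply/existsP; exists z; apply/existsP.
by exists w; rewrite !eqxx eqd eqxx.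
Qed.

Lemma mem_pair_class (X : finType) (disp : Order.disp_t) (L : bOrderType disp)
    (delta : X -> X -> L) x y z w :
  (forall a b, delta a b = delta b a) ->
  ([set z; w] \in pair_class delta x y) = (z != w) && (delta x y == delta z w).
Proof. by move=> dC; rewrite !inE same_delta_set2 // cards2; case: (z != w). Qed.

Lemma DeltaP (X : finType) (disp : Order.disp_t) (L : bOrderType disp)
    (delta : X -> X -> L) (C : {set {set X}}) :
  reflect (exists x y, x != y /\ C = pair_class delta x y) (C \in Delta delta).
Proof.
apply: (iffP imsetP) => [[A]|[x [y [xy ->]]]].
  by rewrite inE => /cards2P[x [y [xy ->]]] ->; exists x, y.
by exists [set x; y]; rewrite // inE cards2 xy.
Qed.

Lemma class_gt_pair_class (X : finType) (disp : Order.disp_t)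
    (L : bOrderType disp) (delta : X -> X -> L) x y z w :
  (forall a b, delta a b = delta b a) ->
  class_gt delta (pair_class delta x y) (pair_class delta z w) ->
  (delta z w < delta x y)%O.
Proof.
move=> dC [a [b [c [d [abC cdD gtd]]]]].
move: abC cdD; rewrite !mem_pair_class //.
by move=> /andP[_ /eqP->] /andP[_ /eqP->].
Qed.

Lemma exists_leftmost (R : realType) (X : finType) (f : X -> R) :
  (0 < #|X|)%N -> exists x0, forall y, f x0 <= f y.
Proof.
case/card_gt0P=> x _; case: (@arg_minP _ _ _ x xpredT f) => // x0 _ Hx0.
by exists x0 => y; apply: Hx0.
Qed.

(** This is where dimension one enters: in the plane a circle centred at [x0]
    may contain several points. *)
Lemma pair_class_leftmost_inj (R : realType) (X : finType) (disp : Order.disp_t)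
    (L : bOrderType disp) (delta : X -> X -> L) (f : X -> R) x0 :
  (forall a b, delta a b = delta b a) -> line_coordinate delta f ->
  (forall y, f x0 <= f y) ->
  {in predC1 x0 &, injective (pair_class delta x0)}.
Proof.
move=> dC Hf minf y z yx0 _ eqC.
have: [set x0; y] \in pair_class delta x0 z.
  by rewrite -eqC mem_pair_class // eqxx eq_sym andbT.
rewrite mem_pair_class // (line_coordinate_eq _ _ _ _ Hf) => /andP[_].
rewrite !(distrC (f x0)) !ger0_norm ?subr_ge0 //.
by rewrite (inj_eq (addIr _)) => /eqP /(proj1 Hf).
Qed.

(** Given the length of a segment of the line, its right end determines its left
    end, so that right ends parametrize the pairs of a class. *)
Lemma card_class_right_ends (R : realType) (X : finType) (disp : Order.disp_t)
    (L : bOrderType disp) (delta : X -> X -> L) (f : X -> R) a b :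
  (forall a b, delta a b = delta b a) -> line_coordinate delta f ->
  (#|pair_class delta a b| <= #|right_ends delta f (delta a b)|)%N.
Proof.
move=> dC Hf; have [injf _] := Hf.
(* The default value [y] is never reached on [right_ends]. *)
pose g y := odflt y [pick x | (f x < f y) && (delta x y == delta a b)].
apply: leq_trans (leq_imset_card (fun y => [set g y; y]) _).
apply: subset_leq_card; apply/subsetP => A AC.
have: A \in unordered_pairs X by move: AC; rewrite inE => /andP[].
rewrite inE => /cards2P[z [w [zw defA]]]; rewrite {A}defA in AC *.
wlog ltf : z w zw AC / f z < f w.
  move=> IH; case: (ltgtP (f z) (f w)) => [|lt|/injf eqzw]; first exact: IH.
    by rewrite setUC; apply: IH; rewrite 1?setUC // eq_sym.
  by rewrite eqzw eqxx in zw.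
move: AC; rewrite mem_pair_class // => /andP[_ /eqP dab].
apply/imsetP; exists w.
  by rewrite inE; apply/existsP; exists z; rewrite ltf dab eqxx.
congr [set _; _]; rewrite /g; case: pickP => [x|/(_ z)]; last first.
  by rewrite ltf dab eqxx.
case/andP=> ltx; rewrite dab (line_coordinate_eq _ _ _ _ Hf) /=.
rewrite !(distrC _ (f w)) !gtr0_norm ?subr_gt0 //.
by rewrite (inj_eq (addrI _)) eqr_opp => /eqP /injf.
Qed.

(** Replacing the left end of a segment by the leftmost point can only lengthen
    the segment. *)
Lemma right_ends_leftmost (R : realType) (X : finType) (disp : Order.disp_t)
    (L : bOrderType disp) (delta : X -> X -> L) (f : X -> R) x0 l y :
  line_coordinate delta f -> (forall z, f x0 <= f z) ->
  y \in right_ends delta f l -> y != x0 /\ (l <= delta x0 y)%O.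
Proof.
move=> Hf minf; rewrite inE => /existsP[x /andP[ltf /eqP <-]]; split.
  by apply: contraTneq ltf => ->; rewrite -leNgt.
rewrite (line_coordinate_le _ _ _ _ Hf) !(distrC _ (f y)).
by rewrite !ger0_norm ?subr_ge0 // ?(ltW ltf) // lerD2l lerN2.
Qed.

(** [class_gt] is only given between consecutive classes; as [delta] is constant
    on each class, the comparisons can be chained along the list. *)
Lemma class_index_lt (X : finType) (disp : Order.disp_t) (L : bOrderType disp)
    (delta : X -> X -> L) (k : nat) (c : nat -> {set {set X}}) i j x y z w :
  (forall a b, delta a b = delta b a) ->
  Delta delta = [set c i.+1 | i : 'I_k] ->
  (forall i, (1 <= i < k)%N -> class_gt delta (c i) (c i.+1)) ->
  (1 <= i)%N -> (i < j <= k)%N ->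
  c i = pair_class delta x y -> c j = pair_class delta z w ->
  (delta z w < delta x y)%O.
Proof.
move=> dC defD decr i1 /andP[ij jk] ci.
elim: j ij jk z w => // j IH; rewrite ltnS leq_eqVlt => /orP[/eqP<-|ij] jk z w cj.
  by apply: (class_gt_pair_class dC); rewrite -ci -cj; apply: decr; rewrite i1.
have j1 : (0 < j)%N by apply: leq_trans ij.
have /DeltaP[p [q [_ cjpq]]] : c j \in Delta delta.
  have jk' : (j.-1 < k)%N by rewrite prednK // ltnW.
  rewrite defD; apply/imsetP; exists (Ordinal jk') => //=.
  by rewrite prednK.
apply: lt_trans (IH ij (ltnW jk) _ _ cjpq).
by apply: (class_gt_pair_class dC); rewrite -cj -cjpq; apply: decr; rewrite j1.
Qed.

(** Right ends of the pairs in [c i] are mapped to the classes of the pairs they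
    form with [x0]; this map is injective and its values are among
    [c 1, ..., c i]. *)
Lemma card_class_le (R : realType) (X : finType) (disp : Order.disp_t)
    (L : bOrderType disp) (delta : X -> X -> L) (f : X -> R) x0
    (k : nat) (c : nat -> {set {set X}}) i :
  (forall a b, delta a b = delta b a) -> line_coordinate delta f ->
  (forall y, f x0 <= f y) ->
  Delta delta = [set c i.+1 | i : 'I_k] ->
  (forall i, (1 <= i < k)%N -> class_gt delta (c i) (c i.+1)) ->
  (1 <= i <= k)%N -> (#|c i| <= i)%N.
Proof.
move=> dC Hf minf defD decr /andP[i1 ik].
have /DeltaP[a [b [ab ci]]] : c i \in Delta delta.
  have ik' : (i.-1 < k)%N by rewrite prednK.
  by rewrite defD; apply/imsetP; exists (Ordinal ik') => //=; rewrite prednK.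
rewrite {1}ci; apply: leq_trans (card_class_right_ends _ _ dC Hf) _.
set P := right_ends _ _ _.
have PP y : y \in P -> y != x0 /\ (delta a b <= delta x0 y)%O.
  exact: right_ends_leftmost.
have injP : {in P &, injective (pair_class delta x0)}.
  move=> y z /PP[yx0 _] /PP[zx0 _].
  exact: (pair_class_leftmost_inj dC Hf minf).
rewrite -(card_in_imset injP) -[leqRHS]card_ord.
apply: leq_trans (leq_imset_card (fun j : 'I_i => c j.+1) _).
apply: subset_leq_card; apply/subsetP => _ /imsetP[y /PP[yx0 led] ->].
have: pair_class delta x0 y \in Delta delta.
  by apply/DeltaP; exists x0, y; rewrite eq_sym.
rewrite defD => /imsetP[j _ cj].
have ji : (j < i)%N.
  (* A class [c j.+1] listed after [c i] would have a smaller distance. *)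
  rewrite ltnNge; apply: contraTN led => ij; rewrite -ltNge.
  by apply: (class_index_lt dC defD decr i1 _ ci (esym cj)); rewrite ltnS ij /=.
by rewrite cj; apply/imsetP; exists (Ordinal ji).
Qed.

(* In the second part, the classes are listed as c 1, ..., c k; the values of c
   outside 1, ..., k are irrelevant. *)
Theorem proposition7p8 (R : realType) (X : finType) (disp : Order.disp_t)
    (L : bOrderType disp) (delta : X -> X -> L) :
  ordinal_space delta ->
  (2 <= #|X|)%N ->
  embeddable R 1 delta ->
  (#|X| - 1 <= #|Delta delta|)%N /\
  (forall (k : nat) (c : nat -> {set {set X}}),
     Delta delta = [set c i.+1 | i : 'I_k] ->
     (forall i : nat, (1 <= i < k)%N -> class_gt delta (c i) (c i.+1)) ->
     #|c 1%N| = 1%N /\ (forall i : nat, (2 <= i <= k)%N -> (#|c i| <= i)%N)).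
Proof.
move=> Hd X2 emb; have [_ dC _] := Hd.
have [f Hf] := embeddable1_coordinate Hd emb.
have [x0 minf] := exists_leftmost f (ltnW X2).
have card_ge : (#|X| - 1 <= #|Delta delta|)%N.
  rewrite subn1 -(cardC1 x0).
  rewrite -(card_in_imset (pair_class_leftmost_inj dC Hf minf)).
  apply: subset_leq_card; apply/subsetP => _ /imsetP[y yx0 ->].
  by apply/DeltaP; exists x0, y; rewrite eq_sym.
split=> // k c defD decr; split; last first.
  move=> i /andP[i2 ik]; apply: (card_class_le dC Hf minf defD decr).
  by rewrite (ltnW i2).
(* By (i) there is at least one class, so that [c 1] is one of them. *)
have k0 : (0 < k)%N.
  rewrite -[k]card_ord; apply: leq_trans (leq_imset_card (fun i : 'I_k => c i.+1) _).
  by rewrite -defD; apply: leq_trans card_ge; rewrite subn_gt0.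
apply/eqP; rewrite eqn_leq (card_class_le dC Hf minf defD decr) //=.
have /DeltaP[x [y [xy ->]]] : c 1%N \in Delta delta.
  by rewrite defD; apply/imsetP; exists (Ordinal k0).
by apply/card_gt0P; exists [set x; y]; rewrite mem_pair_class // xy eqxx.
Qed.
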